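(* Let $\{S(t): t\ge 0\}$ be a semigroup on a nonempty closed subset $V$ of a Banach space $X$, $T>0$ and $\mathbf{B}\subseteq V$ be a bounded absorbing set for the semigroup. Moreover, let $\{S(t): t\ge 0\}$ be asymptotically closed or $\mathbf{B}$ be closed. Assume that one of the following two sets of hypotheses holds: (H1) there are normed spaces $Y,Z$ such that $Z$ is compactly embedded into $Y$, a map $M:\mathbf{B}\to Z$ and parameters $\eta\in[0,1)$, $\mu>0$, $\kappa>0$ such that for all $x,y\in\mathbf{B}$ $$\|Mx-My\|_Z\le\kappa\|x-y\|_X,\qquad \|S(T)x-S(T)y\|_X\le\eta\|x-y\|_X+\mu\|Mx-My\|_Y;$$ (H2) there is a normed space $Y$ such that $X$ is compactly embedded into $Y$ and parameters $\eta\in[0,1)$, $\kappa>0$ such that for all $x,y\in\mathbf{B}$ $$\|S(T)x-S(T)y\|_X\le\eta\|x-y\|_X+\kappa\|x-y\|_Y.$$ Then for any $\sigma\in(0,1-\eta)$ there exists a $T$-discrete exponential attractor $\mathbf{M_0}\subseteq\mathbf{B}$ for the semigroup and its fractal dimension is bounded by $$\dim_f^{V}(\mathbf{M_0})\le\begin{cases}\log_{\frac{1}{\eta+\sigma}}m_{\|\cdot\|_Y}\left(\overline{B}^Z(0,1),\frac{\sigma}{2\mu\kappa}\right)&\text{if (H1) holds},\\ \log_{\frac{1}{\eta+\sigma}}m_{\|\cdot\|_Y}\left(\overline{B}^X(0,1),\frac{\sigma}{2\kappa}\right)&\text{if (H2) holds}.\end{cases}$$ If the semigroup is asymptotically closed,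 it has a global attractor $\mathbf{A}$ contained in $\mathbf{M_0}$.
   Context: $V$ carries the metric $d(x,y)=\|x-y\|_X$. A semigroup $\{S(t):t\ge0\}$ on $V$ is a family of (not necessarily linear) maps $S(t):V\to V$ with $S(t)S(s)=S(t+s)$ for $t,s\ge 0$ and $S(0)=I$; ''$t\ge 0$'' means throughout either $t\in[0,\infty)$ or $t\in\mathbb{N}_0$ (and $T$ belongs to the time set). Asymptotically closed: for any $t\ge 0$, $t_k\ge 0$ with $t_k\to\infty$ and any bounded sequence $x_k\in V$, if $S(t_k)x_k\to x$ and $S(t+t_k)x_k\to y$ with $x,y\in V$, then $S(t)x=y$. Absorbing set: $\mathbf{B}\subseteq V$ such that for every bounded $G\subseteq V$ there is $t_G\ge 0$ with $S(t)G\subseteq\mathbf{B}$ for all $t\ge t_G$. For a normed space $Z$, $\overline{B}^Z(0,1)$ is its closed unit ball; $m_{\|\cdot\|_Y}(F,\varepsilon)$ is the maximal cardinality of a subset $U\subseteq F$ with $\|x-y\|_Y\ge\varepsilon$ for all $x,y\in U$, $x\neq y$. $\mathrm{dist}^V(G,H)=\sup_{x\in G}\inf_{y\in H}d(x,y)$. $N^V(G,\varepsilon)$ is the minimal number of open $\varepsilon$-balls in $V$ centered at points of $G$ needed to cover $G$; $\dim_f^V(G)=\limsup_{\varepsilon\to0^+}\log_{1/\varepsilon}N^V(G,\varepsilon)$. Global attractor: a nonempty compact set $\mathbf{A}\subseteq V$ with $S(t)\mathbf{A}=\mathbf{A}$ for all $t\ge 0$ and $\lim_{t\to\infty}\mathrm{dist}^V(S(t)G,\mathbf{A})=0$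 for every bounded $G\subseteq V$. $T$-discrete exponential attractor: a nonempty compact set $\mathbf{M_0}\subseteq V$ such that $S(T)\mathbf{M_0}\subseteq\mathbf{M_0}$, $\dim_f^V(\mathbf{M_0})<\infty$, and there is $\xi>0$ with $\lim_{t\to\infty}e^{\xi t}\mathrm{dist}^V(S(t)G,\mathbf{M_0})=0$ for every bounded $G\subseteq V$. *)

(* Defs.v *)
From HB Require Import structures.
From mathcomp Require Import all_boot all_order all_algebra.
From mathcomp Require Import all_classical all_reals all_analysis.

Set Implicit Arguments.
Unset Strict Implicit.
Unset Printing Implicit Defensive.

Import Order.TTheory GRing.Theory Num.Theory.
Import numFieldNormedType.Exports.

Local Open Scope classical_set_scope.
Local Open Scope ring_scope.

Variant time_axis := ContinuousTime | DiscreteTime.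

Definition time_set (R : realType) (tau : time_axis) : set R :=
  match tau with
  | ContinuousTime => [set t | 0 <= t]
  | DiscreteTime => range (fun n : nat => n%:R)
  end.
Arguments time_set R tau : clear implicits.

(* Logarithm of an extended real x to a real base b. *)
Definition elog (R : realType) (b : R) (x : \bar R) : \bar R :=
  ((ln b)^-1%:E * lne x)%E.

Section metric_notions.
Context (R : realType) (X : normedModType R).
Implicit Types (V G H : set X) (eps : R).

(* The supremum is taken in [0, +oo], so that the semidistance of the empty set
   to any set is 0 (ereal_sup of the empty set alone would be -oo). *)
Definition semidist G H : \bar R :=
  ereal_sup (0%E |` [set ereal_inf [set `|x - y|%:E | y in H] | x in G]).

(* Equals +oo if no finite cover exists. *)
Definition covering_number V G eps : \bar R :=
  ereal_inf [set n%:R%:E | n in [set n : nat | exists C : set X,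
    [/\ C `<=` G, (C #= `I_n)%card &
        G `<=` \bigcup_(x in C) (ball x eps `&` V)]]].

Definition fractal_dim V G : \bar R :=
  limf_esup (fun eps => elog eps^-1 (covering_number V G eps)) 0^'+.

End metric_notions.

(* Maximal cardinality of a subset of F whose distinct points are eps-separated
   for the norm p, which need not be the norm of the ambient type; +oo if there
   are such subsets of every finite cardinality. *)
Definition separation_number (R : realType) (Z : normedModType R) (p : Z -> R)
    (F : set Z) (eps : R) : \bar R :=
  ereal_sup [set n%:R%:E | n in [set n : nat | exists U : set Z,
    [/\ U `<=` F, (U #= `I_n)%card &
        forall x y, U x -> U y -> x != y -> eps <= p (x - y)]]].

(* Z is a linear subspace of Y through the inclusion iota, so that the Y-norm of
   z in Z is `|iota z|. *)
Definition compact_embedding (R : realType) (Z Y : normedModType R)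
    (iota : {linear Z -> Y}) : Prop :=
  [/\ injective iota, continuous iota &
      forall A : set Z, bounded_set A -> precompact (iota @` A)].

Section semigroups.
Context (R : realType) (X : normedModType R).
Variables (tau : time_axis) (V : set X).

(* Families of maps V -> V are represented by total functions R -> X -> X; only
   their values at times in the time set and at points of V matter. *)
Implicit Types (S : R -> X -> X) (B A M G : set X).

Local Notation TT := (time_set R tau).

Definition semigroup S : Prop :=
  [/\ forall t, TT t -> S t @` V `<=` V,
      forall x, V x -> S 0 x = x &
      forall t s x, TT t -> TT s -> V x -> S t (S s x) = S (t + s) x].

Definition asymptotically_closed S : Prop :=
  forall (t : R) (tk : nat -> R) (xk : nat -> X) (x y : X),
    TT t -> (forall k, TT (tk k)) -> tk @ \oo --> +oo ->
    (forall k, V (xk k)) -> bounded_set (range xk) -> V x -> V y ->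
    S (tk k) (xk k) @[k --> \oo] --> x ->
    S (t + tk k) (xk k) @[k --> \oo] --> y ->
    S t x = y.

Definition absorbing S B : Prop :=
  B `<=` V /\
  forall G, G `<=` V -> bounded_set G ->
    exists2 tG, TT tG & forall t, TT t -> tG <= t -> S t @` G `<=` B.

Definition global_attractor S A : Prop :=
  [/\ A !=set0, compact A, A `<=` V, forall t, TT t -> S t @` A = A &
      forall G, G `<=` V -> bounded_set G ->
        semidist (S t @` G) A @[t --> within TT +oo] --> 0%E].

Definition discrete_exponential_attractor (T : R) S M : Prop :=
  [/\ [/\ M !=set0, compact M & M `<=` V],
      S T @` M `<=` M,
      (fractal_dim V M < +oo)%E &
      exists2 xi : R, 0 < xi & forall G, G `<=` V -> bounded_set G ->
        ((expR (xi * t))%:E * semidist (S t @` G) M)%E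
          @[t --> within TT +oo] --> 0%E].

End semigroups.

Arguments asymptotically_closed {R X} tau V S.
Arguments semigroup {R X} tau V S.
Arguments absorbing {R X} tau V S B.
Arguments global_attractor {R X} tau V S A.
Arguments discrete_exponential_attractor {R X} tau V T S M.

(* Main.v *)
(* Let [D] be the union of [S t @` B] over [t >= t_B]: a positively invariant
   absorbing subset of [B].  A set [F] of diameter at most [r] in [B] is coloured
   with at most [m] colours, [m] being the separation number, by means of a
   maximal [sigma * r / (2 * mu)]-separated family of its image in [Z]; the
   image under [S T] of each colour class has diameter at most
   [(eta + sigma) * r].  Hence [S (n * T) D] has a net of [m ^ n] of its own
   points at scale [(eta + sigma) ^ n * r0].  Let [E] be the forward orbit under
   [S T] of all these nets and [Omega] the intersection of the closures of the
   [S (n * T) D].  As all but finitely many points of [E] lie in [S (n * T) D],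
   the union [M0] of [E] and [Omega] is compact, and its dimension is read off
   from the nets.  If [B] is closed, [Omega] lies in [B] and is stable by
   continuity of [S T] on [B].  If the semigroup is asymptotically closed,
   sequences [x_k] in [S (k * T) D] are relatively compact, whence
   [S t @` Omega = Omega]; then [Omega] is the global attractor, and it is
   contained in [B] because it is absorbed by [B].  (H2) is the case [Z = X],
   [M = id] of (H1). *)

Require Import Defs.
From mathcomp Require Import all_boot all_order all_algebra.
From mathcomp Require Import finmap.
From mathcomp Require Import ring lra.
From mathcomp Require Import all_classical all_reals all_analysis.

Set Implicit Arguments.
Unset Strict Implicit.
Unset Printing Implicit Defensive.

Import Order.TTheory GRing.Theory Num.Theory.
Import numFieldNormedType.Exports.

Local Open Scope classical_set_scope.
Local Open Scope ring_scope.

(** * Compactness, finite nets and separated families *)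

Lemma ultra_bigcup_seq (I : eqType) (T : Type) (F : set_system T) (s : seq I)
    (A : I -> set T) :
  UltraFilter F -> F (\bigcup_(i in [set` s]) A i) -> exists i, F (A i).
Proof.
move=> FU; elim: s => [|i s IHs].
  move=> F0; exfalso; apply: (filter_not_empty F).
  by apply: filterS F0 => x [].
move=> Fs; have [FA|FnA] := in_ultra_setVsetC (A i) FU; first by exists i.
apply: IHs; apply: filterS (filterI Fs FnA) => x [[j]]; rewrite /= inE.
by move=> /orP[/eqP->//|js] Ajx _; exists j.
Qed.

(** An ultrafilter containing [A] contains one of the finitely many balls covering [A], at every
    radius; it is therefore Cauchy, and completeness gives its limit. *)
Lemma closed_totally_bounded_compact (R : realType)
    (X : completeNormedModType R) (A : set X) :
  closed A ->
  (forall e, 0 < e -> exists s : seq X,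
     A `<=` \bigcup_(x in [set` s]) ball x e) ->
  compact A.
Proof.
move=> Acl Atb; rewrite compact_ultra => F FU FA.
have : cauchy F.
  apply: cauchy_exP => e e0; have [s As] := Atb e e0.
  by apply: ultra_bigcup_seq (filterS As FA).
move=> /cauchy_cvg /cvg_ex[p Fp].
by exists p; split => //; apply: (closed_cvg A (u_ := id)) Fp.
Qed.

(** Thanks to this, a finite net with a non-strict bound for a set is also a net for its closure. *)
Lemma closed_finite_net (R : realType) (X : normedModType R) (s : seq X)
    (r : R) :
  closed [set x : X | exists2 u, u \in s & `|x - u| <= r].
Proof.
have -> : [set x : X | exists2 u, u \in s & `|x - u| <= r] =
    \bigcup_(u in [set` s]) [set x | `|x - u| <= r].
  by apply/seteqP; split => x [u us ?]; exists u.
apply: closed_bigcup => [|u _]; first exact: finite_seq.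
apply: (@preimage_closed _ _ (fun x : X => `|x - u|) [set y | y <= r]) => //.
move=> x _; apply: cvg_norm; apply: cvgB; [exact: cvg_id|exact: cvg_cst].
Qed.

Lemma card_eq_seq (T : choiceType) (s : seq T) :
  uniq s -> ([set` s] #= `I_(size s))%card.
Proof.
move=> us; have -> : [set` s] = [set` [fset x in s]%fset].
  by apply/seteqP; split => x /=; rewrite in_fset.
by apply/card_eq_fsetP; rewrite card_fseq undup_id.
Qed.

(** Finitely many balls of radius [e / 2] cover the image, and two [e]-separated points cannot share
    one of them. *)
Lemma precompact_separated_bound (R : realType) (Z Y : normedModType R)
    (iota : {linear Z -> Y}) (F : set Z) (e : R) :
  0 < e -> precompact (iota @` F) ->
  exists N, forall n (U : set Z), U `<=` F -> (U #= `I_n)%card ->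
    (forall x y, U x -> U y -> x != y -> e <= `|iota (x - y)|) -> (n <= N)%N.
Proof.
move=> e0; rewrite precompactE compact_cover.
move=> /(_ Y setT (fun y => ball y (e / 2))); case=> [y _|x _|D _ FD].
  exact: ball_open.
  by exists x => //; apply: ballxx; rewrite divr_gt0.
exists #|` D|%fset => n U UF Un Usep.
have /choice[c cP] : forall x, exists y,
    U x -> y \in D /\ ball y (e / 2) (iota x).
  move=> x; have [Ux|nUx] := pselect (U x); last by exists 0.
  have : closure (iota @` F) (iota x).
    by apply: subset_closure; exists x => //; apply: UF.
  by move=> /FD[y yD xy]; exists y => _.
have cinj : {in U &, injective c}.
  move=> x y; rewrite !inE => Ux Uy cxy; apply/eqP/negP => /negP xy.
  have := Usep _ _ Ux Uy xy; rewrite leNgt => /negP; apply.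
  have [_ xc] := cP x Ux; have [_ yc] := cP y Uy.
  rewrite linearB; have := ball_splitr xc; rewrite cxy => /(_ _ yc).
  by rewrite -ball_normE.
rewrite -card_le_II -(card_le_eql Un).
have Dn : ([set` D] #= `I_#|` D|%fset)%card by apply/card_eq_fsetP.
rewrite -(card_le_eqr Dn) -(card_le_eql (inj_card_eq cinj)).
by apply: subset_card_le => _ [x Ux <-]; have [] := cP x Ux.
Qed.

Lemma separation_number_fin (R : realType) (Z Y : normedModType R)
    (iota : {linear Z -> Y}) (e : R) :
  compact_embedding iota -> 0 < e ->
  exists m : nat, [/\ (0 < m)%N,
    separation_number (fun z => `|iota z|) (closed_ball (0 : Z) 1) e =
      m%:R%:E &
    forall s : seq Z, (forall x, x \in s -> `|x| <= 1) ->
      pairwise (fun x y => e <= `|iota (x - y)|) s -> (size s <= m)%N].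
Proof.
move=> [_ _ iota_cpt] e0; set F := closed_ball (0 : Z) 1.
have FE x : F x <-> `|x| <= 1.
  by rewrite /F closed_ballE// /closed_ball_ /= sub0r normrN.
have Fb : bounded_set F.
  exists 1; split => // M M1 x /FE x1; exact: le_trans x1 (ltW M1).
have [N NP] := precompact_separated_bound e0 (iota_cpt _ Fb).
pose P n := exists U : set Z, [/\ U `<=` F, (U #= `I_n)%card &
  forall x y, U x -> U y -> x != y -> e <= `|iota (x - y)|].
have PN n : `[< P n >] -> (n <= N)%N.
  by move=> /asboolP[U [UF Un Us]]; apply: NP Us.
(* A single point is separated; this makes [m] positive, so that [ln m] is nonnegative in the
   dimension bound. *)
have P1 : P 1%N.
  exists [set` [:: 0 : Z]]; split.
  - by move=> x /=; rewrite inE => /eqP ->; apply/FE; rewrite normr0.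
  - exact: (@card_eq_seq _ [:: 0]).
  - by move=> x y; rewrite /= !inE => /eqP -> /eqP ->; rewrite eqxx.
have exP : exists n, `[< P n >] by exists 1%N; apply/asboolP.
case: (ex_maxnP exP PN) => m /asboolP Pm mmax.
have mP n : P n -> (n <= m)%N by move=> Pn; apply: mmax; apply/asboolP.
exists m; split; first exact: mP.
- apply/eqP; rewrite eq_le; apply/andP; split.
    apply: ge_ereal_sup => _ [n Pn <-].
    by rewrite lee_fin ler_nat; apply: mP.
  by apply: ereal_sup_ubound; exists m.
- move=> s s1 sep; apply: mP; exists [set` s]; split.
  + by move=> x /= /s1 /FE.
  + apply: card_eq_seq; rewrite uniq_pairwise; apply: sub_pairwise sep => x y.
    apply: contraTneq => ->; rewrite subrr linear0 normr0 -ltNge //.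
  + move: sep; elim: s {s1} => [_ x y//|a s IHs] /= /andP[/allP sa ss] x y.
    rewrite !inE => /orP[/eqP->|xs] /orP[/eqP->|ys]; rewrite ?eqxx//.
    * by move=> _; apply: sa.
    * by move=> _; rewrite -normrN -linearN opprB; apply: sa.
    * exact: IHs.
Qed.

(* Controlling diameters rather than radii is what gives the contraction factor
   [eta + sigma] instead of [2 * eta + sigma]. *)
Lemma quasi_stable_coloring (R : realType) (X Y Z : normedModType R)
    (iota : {linear Z -> Y}) (f : X -> X) (M : X -> Z) (B : set X)
    (eta mu kappa sigma : R) (m : nat) :
  0 < mu -> 0 < kappa -> 0 <= eta -> 0 < sigma ->
  (forall x y, B x -> B y ->
    `|M x - M y| <= kappa * `|x - y| /\
    `|f x - f y| <= eta * `|x - y| + mu * `|iota (M x - M y)|) ->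
  (forall s : seq Z, (forall x, x \in s -> `|x| <= 1) ->
    pairwise (fun x y => sigma / (2 * mu * kappa) <= `|iota (x - y)|) s ->
    (size s <= m)%N) ->
  forall (F : set X) (r : R), 0 < r -> F `<=` B ->
  (forall x y, F x -> F y -> `|x - y| <= r) ->
  exists c : X -> nat, (forall x, F x -> (c x < m)%N) /\
    (forall x y, F x -> F y -> c x = c y ->
       `|f x - f y| <= (eta + sigma) * r).
Proof.
move=> mu0 kappa0 eta0 sigma0 qs mP F r r0 FB Fr.
(* Images within [d] of a common one are within [2 * d] of each other, and
   [mu * (2 * d) = sigma * r]. *)
pose d := sigma * r / (2 * mu).
pose sep := fun x y : X => d <= `|iota (M x - M y)|.
pose P n := exists s : seq X, [/\ size s = n, (forall x, x \in s -> F x) &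
  pairwise sep s].
have kr0 : 0 < kappa * r by rewrite mulr_gt0.
have Pm n : `[< P n >] -> (n <= m)%N.
  move=> /asboolP[[|a s] [<- sF ss]]//.
  (* Translating by [M a] and dividing by [kappa * r] moves the images into the unit ball of [Z] and
     turns the scale [d] into [sigma / (2 * mu * kappa)]. *)
  rewrite -(size_map (fun x => (kappa * r)^-1 *: (M x - M a))).
  apply: mP => [_ /mapP[x xs ->]|].
    have [Mx _] := qs _ _ (FB _ (sF _ xs)) (FB _ (sF _ (mem_head a s))).
    rewrite normrZ gtr0_norm ?invr_gt0// ler_pdivrMl// mulr1.
    apply: le_trans Mx _; rewrite ler_pM2l//.
    by apply: Fr; apply: sF => //; apply: mem_head.
  rewrite pairwise_map; apply: sub_pairwise ss => x y; rewrite /sep /=.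
  rewrite -scalerBr opprB addrA subrK linearZ normrZ.
  rewrite gtr0_norm ?invr_gt0// => dxy.
  rewrite ler_pdivlMl//; apply: le_trans dxy.
  by rewrite /d le_eqVlt; apply/orP; left; apply/eqP; field; rewrite !gt_eqF.
have exP : exists n, `[< P n >] by exists 0%N; apply/asboolP; exists [::].
case: (ex_maxnP exP Pm) => k Pk kmax; have km := Pm _ Pk.
move/asboolP: Pk => [s [sk sF ss]].
pose near x := fun y : X => `|iota (M x - M y)| < d.
have nearP x : F x -> has (near x) s.
  move=> Fx; apply/negP => /negP/hasPn nx.
  have /kmax : `[< P k.+1 >]; last by rewrite ltnn.
  apply/asboolP; exists (x :: s); split => /=; first by rewrite sk.
    by move=> y; rewrite inE => /orP[/eqP ->//|]; apply: sF.
  by rewrite ss andbT; apply/allP => y /nx; rewrite /near -leNgt.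
(* By maximality of [s] every point of [F] is near some entry; its colour is the index of the first
   one, so points of one colour share that entry. *)
exists (fun x => find (near x) s); split => [x Fx|x y Fx Fy cxy].
  by apply: leq_trans km; rewrite -sk -has_find; apply: nearP.
have := nth_find x (nearP _ Fx); have := nth_find x (nearP _ Fy).
rewrite -cxy /near; set z := nth _ _ _ => yz xz.
have [_ /le_trans -> //] := qs _ _ (FB _ Fx) (FB _ Fy).
rewrite mulrDl lerD ?ler_wpM2l ?Fr//.
have -> : sigma * r = mu * (d + d) by rewrite /d; field; rewrite gt_eqF.
rewrite ler_pM2l//; have -> : M x - M y = (M x - M z) - (M y - M z).
  by rewrite opprB addrA subrK.
by rewrite linearB; apply: le_trans (ler_normB _ _) _; rewrite lerD// ltW.
Qed.

(** * Iterates of a map contracting up to finitely many classes *)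

Section discrete_dynamics.
Context (R : realType) (X : completeNormedModType R) (f : X -> X)
  (D : set X) (q r0 : R) (m : nat).
Context (m_gt0 : (0 < m)%N) (q01 : 0 < q < 1) (r0_gt0 : 0 < r0)
  (D0 : D !=set0) (fD : f @` D `<=` D)
  (D_diam : forall x y, D x -> D y -> `|x - y| <= r0)
  (f_coloring : forall (F : set X) (r : R), 0 < r -> F `<=` D ->
    (forall x y, F x -> F y -> `|x - y| <= r) ->
    exists c : X -> nat, (forall x, F x -> (c x < m)%N) /\
      (forall x y, F x -> F y -> c x = c y -> `|f x - f y| <= q * r)).

Definition iter_image n : set X := iter n f @` D.
Definition omega_limit : set X := \bigcap_n closure (iter_image n).
Local Notation W := iter_image.

Lemma iter_stable n x : D x -> D (iter n f x).
Proof. by move=> Dx; elim: n => //= n IHn; apply: fD; exists (iter n f x). Qed.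

Lemma iter_image_iter n k x : W n x -> W (k + n) (iter k f x).
Proof. by move=> [y Dy <-]; exists y; rewrite ?iterD. Qed.

Lemma iter_image_decr n k : (n <= k)%N -> W k `<=` W n.
Proof.
move=> nk _ [x Dx <-]; exists (iter (k - n) f x); first exact: iter_stable.
by rewrite -iterD subnKC.
Qed.

Lemma iter_image_sub n : W n `<=` D.
Proof. by move=> _ [x Dx <-]; apply: iter_stable. Qed.

Lemma geometric_lt e : 0 < e -> exists n, q ^+ n * r0 < e.
Proof.
move=> e0; have [q0 q1] := andP q01.
have : `|q| < 1 by rewrite gtr0_norm.
move=> /cvg_expr /cvgr0_norm_lt /(_ (e / r0)).
rewrite divr_gt0// => /(_ isT)[n _ /(_ n (leqnn n))].
by rewrite gtr0_norm ?exprn_gt0// ltr_pdivlMr// => ?; exists n.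
Qed.

(** The colour at stage [n.+1] records the colour at stage [n] together with the colour of the
    [n]-th iterate inside the image of that class. *)
Lemma iter_coloring n : exists c : X -> nat,
  (forall x, D x -> (c x < m ^ n)%N) /\
  (forall x y, D x -> D y -> c x = c y ->
     `|iter n f x - iter n f y| <= q ^+ n * r0).
Proof.
have [q0 _] := andP q01.
elim: n => [|n [c [cm cP]]].
  by exists (fun=> 0%N); split => // x y Dx Dy _; rewrite mul1r; apply: D_diam.
pose F j := iter n f @` [set x | D x /\ c x = j].
have /choice[g gP] : forall j, exists g : X -> nat,
    (forall x, F j x -> (g x < m)%N) /\
    (forall x y, F j x -> F j y -> g x = g y ->
       `|f x - f y| <= q * (q ^+ n * r0)).
  move=> j; apply: f_coloring; first by rewrite mulr_gt0 ?exprn_gt0.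
    by move=> _ [x [Dx _] <-]; apply: iter_stable.
  by move=> _ _ [x [Dx cx] <-] [y [Dy cy] <-]; apply: cP => //; rewrite cx cy.
have FP x : D x -> F (c x) (iter n f x) by move=> Dx; exists x.
(* The two colours are encoded in base [m]: division by [m] recovers the first, and then the
   second. *)
exists (fun x => c x * m + g (c x) (iter n f x))%N; split.
  move=> x Dx; rewrite expnSr.
  apply: (@leq_trans (c x * m + m)); last by rewrite -mulSnr leq_mul2r cm ?orbT.
  by rewrite ltn_add2l; have [/(_ _ (FP _ Dx))] := gP (c x).
move=> x y Dx Dy cxy.
have gx : (g (c x) (iter n f x) < m)%N by have [/(_ _ (FP _ Dx))] := gP (c x).
have gy : (g (c y) (iter n f y) < m)%N by have [/(_ _ (FP _ Dy))] := gP (c y).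
have ecxy : c x = c y.
  by move: (congr1 (divn^~ m) cxy); rewrite !divnMDl// !divn_small// !addn0.
move: cxy; rewrite ecxy => /addnI gxy.
rewrite exprS -mulrA; have [_] := gP (c y); apply => //; last exact: FP.
by rewrite -ecxy; apply: FP.
Qed.

(** One iterate is taken from each colour class; the non-strict bound extends the net property to
    the closure. *)
Lemma iter_image_net n : exists s : seq X, [/\ size s = (m ^ n)%N,
  forall x, x \in s -> W n x &
  forall x, closure (W n) x -> exists2 u, u \in s & `|x - u| <= q ^+ n * r0].
Proof.
have [c [cm cP]] := iter_coloring n.
have [d Dd] := D0.
(* Colours that do not occur get an arbitrary point of [D], so the list has exactly [m ^ n]
   entries. *)
have /choice[z zP] : forall j, exists z,
    D z /\ ((exists2 x, D x & c x = j) -> c z = j).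
  move=> j; have [[x Dx cx]|nx] := pselect (exists2 x, D x & c x = j).
    by exists x.
  by exists d; split => // /nx.
pose s := [seq iter n f (z j) | j <- iota 0 (m ^ n)].
exists s; split; first by rewrite size_map size_iota.
  by move=> _ /mapP[j _ ->]; exists (z j) => //; have [] := zP j.
apply: subset_trans _ (@closed_finite_net _ _ s (q ^+ n * r0)).
apply: closureS => _ [x Dx <-].
have [Dz cz] := zP (c x); exists (iter n f (z (c x))).
  by apply/mapP; exists (c x) => //; rewrite mem_iota cm.
by apply: cP => //; rewrite cz//; exists x.
Qed.

(** Apart from its first [n] terms the sequence lies in [W n], which has a finite net, so its range
    is relatively compact. A cluster point belongs to the closure of every [W n] because the tails
    do. *)
Lemma omega_limit_subsequence (x : nat -> X) : (forall k, W k (x k)) ->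
  exists2 p, omega_limit p &
  exists2 phi : nat -> nat, (forall j, (j <= phi j)%N) &
    x (phi j) @[j --> \oo] --> p.
Proof.
move=> Wx.
have : compact (closure (range x)).
  apply: closed_totally_bounded_compact => [|e e0]; first exact: closed_closure.
  have [n ne] := geometric_lt e0; have [s [_ _ sP]] := iter_image_net n.
  exists (s ++ [seq x k | k <- iota 0 n]).
  pose N := [set y | exists2 u, u \in s ++ [seq x k | k <- iota 0 n] &
    `|y - u| <= q ^+ n * r0].
  apply: (@subset_trans _ N); last first.
    move=> y [u us yu]; exists u => //=.
    by rewrite -ball_normE /= distrC; apply: le_lt_trans ne.
  apply: subset_trans _ (@closed_finite_net _ _ _ _).
  apply: closureS => _ [k _ <-]; have [kn|nk] := ltnP k n.
    exists (x k); last first.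
      rewrite subrr normr0 mulr_ge0 ?exprn_ge0 ?ltW//.
      by case/andP: q01.
    by rewrite mem_cat; apply/orP; right; apply/mapP; exists k;
      rewrite ?mem_iota.
  have [|u us xu] := sP (x k).
    by apply: subset_closure; apply: iter_image_decr (Wx k).
  by exists u => //; rewrite mem_cat us.
move=> /(_ (x @ \oo) (fmap_proper_filter _ _)) [|p [_ clp]].
  by exists 0%N => // k _; apply: subset_closure; exists k.
have /choice[phi phiP] : forall j, exists k,
    (j <= k)%N /\ `|p - x k| < j.+1%:R^-1.
  move=> j; have j0 : 0 < j.+1%:R^-1 :> R by rewrite invr_gt0.
  have [|_ [[k jk <-] pk]] := clp (x @` [set k | (j <= k)%N])
      (ball p j.+1%:R^-1) _ (nbhsx_ballx _ _ j0).
  - by exists j => // k jk; exists k.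
  - by exists k; split => //; move: pk; rewrite -ball_normE.
have xp : x (phi j) @[j --> \oo] --> p.
  apply/cvgrPdist_lt => e e0.
  have := near_infty_natSinv_lt (PosNum e0); apply: filterS => j /=.
  by apply: lt_trans; have [] := phiP j.
exists p; last by exists phi => // j; have [] := phiP j.
move=> n _; apply: (closed_cvg _ _ _ _ xp); first exact: closed_closure.
exists n => // j nj; apply: subset_closure.
apply: iter_image_decr (Wx (phi j)).
by apply: leq_trans nj _; have [] := phiP j.
Qed.

Lemma omega_limit_neq0 : omega_limit !=set0.
Proof.
have [d Dd] := D0.
have [|p Lp _] := @omega_limit_subsequence (fun k => iter k f d).
  by move=> k; exists d.
by exists p.
Qed.

Lemma omega_limit_compact : compact omega_limit.
Proof.
apply: closed_totally_bounded_compact => [|e e0].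
  by apply: closed_bigI => n _; apply: closed_closure.
have [n ne] := geometric_lt e0; have [s [_ _ sP]] := iter_image_net n.
exists s => x /(_ n Logic.I)/sP[u us xu]; exists u => //=.
by rewrite -ball_normE /= distrC; apply: le_lt_trans ne.
Qed.

(** Otherwise points of the sets [W k] could be chosen at distance at least [e] from the limit set,
    although a subsequence converges to a point of it. *)
Lemma omega_limit_attracts e : 0 < e ->
  exists N, forall x, W N x -> exists2 p, omega_limit p & `|x - p| < e.
Proof.
move=> e0; apply: contrapT => /forallNP nN.
have /choice[x xP] : forall k, exists x,
    W k x /\ forall p, omega_limit p -> e <= `|x - p|.
  move=> k; have /existsNP[x /not_implyP[Wx nx]] := nN k.
  exists x; split => // p Lp; rewrite leNgt; apply/negP => xp.
  by apply: nx; exists p.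
have [k|p Lp [phi _]] := @omega_limit_subsequence x.
  by have [] := xP k.
move=> /cvgrPdist_lt /(_ e e0)[j _ /(_ j (leqnn j))] /=; rewrite distrC ltNge.
by have [_ /(_ p Lp) ->] := xP (phi j).
Qed.

(** The number of iterations equals the index, so it tends to infinity along subsequences, as
    asymptotic closedness requires. *)
Lemma omega_limit_seq p : omega_limit p ->
  exists2 d : nat -> X, (forall k, D (d k)) & iter k f (d k) @[k --> \oo] --> p.
Proof.
move=> Lp.
have /choice[d dP] : forall k, exists d, D d /\ `|p - iter k f d| < k.+1%:R^-1.
  move=> k; have k0 : 0 < k.+1%:R^-1 :> R by rewrite invr_gt0.
  have [_ [[d Dd <-] pd]] := Lp k Logic.I _ (nbhsx_ballx p _ k0).
  by exists d; split => //; move: pd; rewrite -ball_normE.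
exists d => [k|]; first by have [] := dP k.
apply/cvgrPdist_lt => e e0.
have := near_infty_natSinv_lt (PosNum e0); apply: filterS => k /=.
by apply: lt_trans; have [] := dP k.
Qed.

(** Taking whole orbits of the net points makes [E] forward invariant; the price is the factor
    [n.+1 ^ 2], which vanishes in the dimension. *)
Lemma exponential_core : exists E : set X, [/\ E `<=` D, f @` E `<=` E,
  compact (E `|` omega_limit),
  forall n x, W n x -> exists2 y, E y & `|x - y| <= q ^+ n * r0 &
  forall n, exists s : seq X, [/\ (size s <= n.+1 ^ 2 * m ^ n)%N,
    forall u, u \in s -> E u &
    forall x, (E `|` omega_limit) x ->
      exists2 u, u \in s & `|x - u| <= q ^+ n * r0]].
Proof.
have [q0 _] := andP q01.
have /choice[s sP] := iter_image_net.
pose E := [set x | exists k l u, u \in s l /\ x = iter k f u].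
pose t n := [seq iter k f u | k <- iota 0 n.+1,
                              u <- flatten [seq s l | l <- iota 0 n.+1]].
have tE n u : u \in t n -> E u.
  move=> /allpairsP[[k v] [_ vt ->]]; have [l _ vs] := flatten_mapP vt.
  by exists k, l, v.
have sE n x : x \in s n -> x \in t n.
  move=> xs; apply/allpairsP; exists (0%N, x); split => //.
  by apply/flatten_mapP; exists n => //; rewrite mem_iota ltnS leqnn.
(* If [k] or [l] exceeds [n], the point lies in [W (k + l)], hence in [W n]; all other pairs are
   listed in [t n]. *)
have EW n x : E x -> x \in t n \/ W n x.
  move=> [k [l [u [us ->]]]].
  have Wu : W (k + l) (iter k f u).
    by apply: iter_image_iter; have [_ + _] := sP l; apply.
  have [kn|kn] := ltnP n k.
    by right; apply: iter_image_decr Wu; rewrite ltnW// ltn_addr.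
  have [ln|ln] := ltnP n l.
    by right; apply: iter_image_decr Wu; rewrite ltnW// ltn_addl.
  left; apply/allpairsP; exists (k, u); split => //.
    by rewrite mem_iota ltnS.
  by apply/flatten_mapP; exists l => //; rewrite mem_iota ltnS.
have tP n x : (E `|` omega_limit) x ->
    exists2 u, u \in t n & `|x - u| <= q ^+ n * r0.
  have cW y : closure (W n) y ->
      exists2 u, u \in t n & `|y - u| <= q ^+ n * r0.
    by have [_ _ h] := sP n; move=> /h[u us yu]; exists u => //; apply: sE.
  move=> [/(EW n)[xt|/subset_closure/cW//]|/(_ n Logic.I)/cW//].
  by exists x; rewrite // subrr normr0 mulr_ge0 ?exprn_ge0 ?ltW.
exists E; split.
- move=> _ [k [l [u [us ->]]]]; apply: iter_stable.
  by have [_ + _] := sP l => /(_ u us)/iter_image_sub.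
- by move=> _ [_ [k [l [u [us ->]]]] <-]; exists k.+1, l, u.
- apply: closed_totally_bounded_compact => [x Ex|e e0]; last first.
    have [n ne] := geometric_lt e0; exists (t n) => x /(tP n)[u ut xu].
    exists u => //=; rewrite -ball_normE /= distrC; exact: le_lt_trans ne.
  (* A point of the closure outside the limit set avoids some [closure (W n)], hence lies in the
     finite set [t n], written below as a net of radius 0. *)
  have [|/existsNP[n /not_implyP[_ nWx]]] := pselect (omega_limit x).
    by right.
  have : closed ([set y : X | exists2 u, u \in t n & `|y - u| <= 0] `|`
                 closure (W n)).
    apply: closedU; [exact: closed_finite_net|exact: closed_closure].
  move=> /(_ x) []; last by [].
    apply: closureS Ex => y [/(EW n)[yt|Wy]|Ly].
    + by left; exists y => //; rewrite subrr normr0.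
    + by right; apply: subset_closure.
    + by right; apply: Ly.
  move=> [u ut]; rewrite normr_le0 subr_eq0 => /eqP ->.
  by left; apply: tE ut.
- move=> n x Wx; have [_ _ h] := sP n.
  have [u us xu] := h _ (subset_closure Wx).
  by exists u => //; exists 0%N, n, u.
- move=> n; exists (t n); split => //; last exact: tP; last exact: tE.
  (* There are [n.+1] values of [k] and [n.+1] nets, each of size at most [m ^ n] because [m] is at
     least 1. *)
  rewrite size_allpairs size_iota expnS expn1 -mulnA; apply: leq_mul => //.
  rewrite size_flatten /shape -map_comp.
  have sum_le r : (forall l, l \in r -> (size (s l) <= m ^ n)%N) ->
      (sumn [seq size (s l) | l <- r] <= size r * m ^ n)%N.
    elim: r => //= l r IHr lr; rewrite mulSn leq_add//.
      by apply: lr; rewrite mem_head.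
    by apply: IHr => k kr; apply: lr; rewrite inE kr orbT.
  rewrite -[X in (_ <= X * _)%N](size_iota 0 n.+1); apply: sum_le => l.
  rewrite mem_iota /= ltnS => ln.
  by have [-> _ _] := sP l; rewrite leq_pexp2l.
Qed.

End discrete_dynamics.

(** * Fractal dimension *)

Lemma lne_le_ln (R : realType) (x : \bar R) (y : R) :
  0 < y -> (x <= y%:E)%E -> (lne x <= (ln y)%:E)%E.
Proof.
move=> y0; case: x => [r||] /=; [|by rewrite leye_eq|by move=> _; apply: leNye].
rewrite lee_fin => ry; case: ifPn => [_|]; first exact: leNye.
by rewrite -ltNge => r0; rewrite lee_fin ler_ln.
Qed.

(* With [c := delta * a / 4], [ln y <= c * y - ln c] absorbs the logarithmic
   term in half of the slack [delta * L]. *)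
Lemma linear_log_growth (R : realType) (a l c0 delta : R) :
  0 < a -> 0 <= l -> 0 <= c0 -> 0 < delta ->
  exists2 L0, 0 < L0 & forall L, L0 <= L -> exists n : nat,
    L + c0 < n%:R * a /\
    2 * ln n.+1%:R + n%:R * l <= (l / a + delta) * L.
Proof.
move=> a0 l0 c00 delta0; pose c := delta * a / 4.
have c_gt0 : 0 < c by rewrite divr_gt0// mulr_gt0.
pose C1 := c0 / a + 1.
pose K := delta * a * (C1 + 1) / 2 - 2 * ln c + C1 * l.
(* [K] collects the terms independent of [L]; beyond this threshold it fits into the other half of
   the slack. *)
exists (2 * `|K| / delta + 1) => [|L LL].
  by rewrite ltr_wpDl// divr_ge0 ?mulr_ge0// ltW.
have KL : K <= delta * L / 2.
  have : 2 * `|K| / delta <= L by apply: le_trans LL; rewrite lerDl.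
  by rewrite ler_pdivrMr//; have := ler_norm K; lra.
have L0 : 0 <= L.
  by apply: le_trans LL; rewrite addr_ge0// divr_ge0 ?mulr_ge0// ltW.
have La0 : 0 <= (L + c0) / a by rewrite divr_ge0 ?addr_ge0// ltW.
(* Rounding down and adding 1 gives the strict inequality; hence the [n.+2] below. *)
exists (Num.truncn ((L + c0) / a)).+1.
set n := Num.truncn _.
have nle : n.+1%:R <= L / a + C1.
  by rewrite -natr1 /C1 addrA -mulrDl lerD2r truncn_le.
split; first by rewrite -ltr_pdivrMr// truncnS_gt.
have lnn : ln n.+2%:R <= c * n.+2%:R - ln c.
  rewrite lerBrDr -lnM ?posrE// mulrC.
  by apply/ltW/ln_sublinear; rewrite mulr_gt0.
have {}lnn : 2 * ln n.+2%:R <=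
    delta * L / 2 + (delta * a * (C1 + 1) / 2 - 2 * ln c).
  have : c * n.+2%:R <= c * (L / a + C1 + 1).
    by rewrite ler_pM2l// -natr1 lerD2r.
  have -> : c * (L / a + C1 + 1) = delta * L / 4 + delta * a * (C1 + 1) / 4.
    by rewrite /c; field; rewrite gt_eqF.
  by move: lnn; lra.
have nl : n.+1%:R * l <= l / a * L + C1 * l.
  have -> : l / a * L + C1 * l = (L / a + C1) * l by ring.
  exact: ler_wpM2r.
by move: lnn nl KL; rewrite /K mulrDl; lra.
Qed.

Lemma covering_number_le (R : realType) (X : normedModType R) (V G : set X)
    (s : seq X) (r eps : R) :
  G `<=` V -> (forall u, u \in s -> G u) -> r < eps ->
  (forall x, G x -> exists2 u, u \in s & `|x - u| <= r) ->
  (covering_number V G eps <= (size s)%:R%:E)%E.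
Proof.
move=> GV sG reps Gs; apply: (@le_trans _ _ (size (undup s))%:R%:E); last first.
  by rewrite lee_fin ler_nat size_undup.
apply: ereal_inf_lbound; exists (size (undup s)) => //.
exists [set` s]; split => //.
  have -> : [set` s] = [set` undup s].
    by apply/seteqP; split => x /=; rewrite mem_undup.
  by apply: card_eq_seq; apply: undup_uniq.
move=> x Gx; have [u us xu] := Gs x Gx; exists u => //; split; last exact: GV.
by rewrite -ball_normE /= distrC; apply: le_lt_trans reps.
Qed.

(** With [L = ln (1 / eps)], some [n] satisfies [q ^ n * r0 < eps] while the logarithm of the size
    of the [n]-th net is at most [(ln m / ln (1 / q) + delta) * L]. *)
Lemma fractal_dim_le (R : realType) (X : normedModType R) (V G : set X)
    (q r0 : R) (m : nat) :
  (0 < m)%N -> 0 < q < 1 -> 0 < r0 -> G `<=` V ->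
  (forall n, exists s : seq X, [/\ (size s <= n.+1 ^ 2 * m ^ n)%N,
    forall u, u \in s -> G u &
    forall x, G x -> exists2 u, u \in s & `|x - u| <= q ^+ n * r0]) ->
  (fractal_dim V G <= elog q^-1 m%:R%:E)%E.
Proof.
move=> m0 /andP[q0 q1] r00 GV nets.
have a0 : 0 < ln q^-1 by rewrite ln_gt0// invf_gt1.
have l0 : 0 <= ln (m%:R : R) by rewrite ln_ge0// ler1n.
rewrite /elog lne_EFin ?ltr0n// -EFinM; apply/lee_addgt0Pr => delta delta0.
have [L0 L00 LP] := linear_log_growth a0 l0 (normr_ge0 (ln r0)) delta0.
(* The upper limit is an infimum over neighbourhoods, so a bound on this one is enough; on it
   [ln (1 / eps)] exceeds [L0]. *)
pose I := [set eps : R | 0 < eps < expR (- L0)].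
apply: (@le_trans _ _ (ereal_sup
    [set elog eps^-1 (covering_number V G eps) | eps in I])).
  apply: ereal_inf_lbound; exists I => //; rewrite /I /=.
  near=> eps; apply/andP; split; near: eps; first exact: nbhs_right_gt.
  by apply: nbhs_right_lt; apply: expR_gt0.
apply: ge_ereal_sup => _ [eps /= /andP[eps0 epsL] <-].
have Leps : L0 < ln eps^-1.
  by rewrite lnV ?posrE// ltrNr -[X in _ < X]expRK ltr_ln ?posrE// expR_gt0.
have [n [nL nle]] := LP _ (ltW Leps); have [s [ss sG sP]] := nets n.
have rn : q ^+ n * r0 < eps.
  rewrite -ltr_ln ?posrE ?mulr_gt0 ?exprn_gt0// lnM ?posrE ?exprn_gt0//.
  move: nL; rewrite lnXn// !lnV ?posrE// -mulr_natl mulrN => nL.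
  by have := ler_norm (ln r0); move: nL; lra.
have /lne_le_ln : (covering_number V G eps <= (n.+1 ^ 2 * m ^ n)%:R%:E)%E.
  apply: le_trans (covering_number_le GV sG rn sP) _.
  by rewrite lee_fin ler_nat.
rewrite ltr0n muln_gt0 !expn_gt0 m0 => /(_ isT) lnN.
apply: (@le_trans _ _ ((ln eps^-1)^-1%:E *
    (ln (n.+1 ^ 2 * m ^ n)%:R)%:E)%E).
  apply: lee_wpmul2l => //; rewrite lee_fin invr_ge0.
  by apply: ltW; apply: lt_trans Leps.
rewrite -EFinM -EFinD lee_fin ler_pdivrMl; last exact: lt_trans Leps.
rewrite natrM !natrX lnM ?posrE ?exprn_gt0 ?ltr0n// !lnXn ?ltr0n//.
by rewrite -[_ *+ 2]mulr_natl -[_ *+ n]mulr_natl [X in _ <= X]mulrC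
  [X in X + delta]mulrC.
Unshelve. all: by end_near. Qed.

(** * Attractors *)

Lemma semidist_le (R : realType) (X : normedModType R) (G H : set X) (e : R) :
  0 <= e -> (forall x, G x -> exists2 y, H y & `|x - y| <= e) ->
  (semidist G H <= e%:E)%E.
Proof.
move=> e0 GH; apply: ge_ereal_sup => _ [->|[x Gx <-]]; first by rewrite lee_fin.
have [y Hy xy] := GH x Gx; apply: (@le_trans _ _ `|x - y|%:E).
  by apply: ereal_inf_lbound; exists y.
by rewrite lee_fin.
Qed.

Lemma semidist_ge0 (R : realType) (X : normedModType R) (G H : set X) :
  (0 <= semidist G H)%E.
Proof. by apply: ereal_sup_ubound; left. Qed.

Lemma ge0_cvge0 (R : realType) (T : Type) (F : set_system T) (g : T -> \bar R) :
  Filter F -> (forall t, (0 <= g t)%E) ->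
  (forall e : R, 0 < e -> \forall t \near F, (g t <= e%:E)%E) ->
  g t @[t --> F] --> 0%E.
Proof.
move=> FF g0 gF; apply/fine_cvgP; split.
  apply: filterS (gF 1 ltr01) => t gt1.
  by rewrite ge0_fin_numE//; apply: le_lt_trans gt1 (ltry _).
apply/cvgr0Pnorm_le => e e0; apply: filterS (gF e e0) => t gte /=.
have gfin : g t \is a fin_num.
  by rewrite ge0_fin_numE//; apply: le_lt_trans gte (ltry _).
by rewrite ger0_norm ?fine_ge0// -lee_fin fineK.
Qed.

(** * Arithmetic of the time set *)

Section time.
Context (R : realType) (tau : time_axis).
Local Notation TT := (time_set R tau).

Lemma time_set_ge0 t : TT t -> 0 <= t.
Proof. by case: tau => //= -[n _ <-]. Qed.

Lemma time_set0 : TT 0.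
Proof. by case: tau => /=; [exact: lexx|exists 0%N]. Qed.

Lemma time_setD s t : TT s -> TT t -> TT (s + t).
Proof.
case: tau => /= [|[n _ <-] [k _ <-]]; first exact: addr_ge0.
by exists (n + k)%N; rewrite ?natrD.
Qed.

Lemma time_setB s t : TT s -> TT t -> s <= t -> TT (t - s).
Proof.
case: tau => /= [_ _|[n _ <-] [k _ <-]]; first by rewrite subr_ge0.
by rewrite ler_nat => nk; exists (k - n)%N; rewrite ?natrB.
Qed.

Lemma time_setMn n t : TT t -> TT (n%:R * t).
Proof.
move=> Tt; elim: n => [|n IHn]; first by rewrite mul0r; apply: time_set0.
by rewrite -natr1 mulrDl mul1r; apply: time_setD.
Qed.

End time.

Lemma invariant_absorbing_subset (R : realType) (X : normedModType R)
    (tau : time_axis) (V : set X) (S : R -> X -> X) (B : set X) :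
  V !=set0 -> semigroup tau V S -> bounded_set B -> absorbing tau V S B ->
  exists D : set X, [/\ D `<=` B, D !=set0,
    forall t, time_set R tau t -> S t @` D `<=` D &
    forall G, G `<=` V -> bounded_set G ->
      exists2 t0, time_set R tau t0 &
        forall t, time_set R tau t -> t0 <= t -> S t @` G `<=` D].
Proof.
move=> [v Vv] [SV S0 SD] Bb [BV Babs].
have [tB TtB SB] := Babs _ BV Bb.
pose D := [set y | exists t b,
  [/\ time_set R tau t, tB <= t, B b & y = S t b]].
have Dabs G : G `<=` V -> bounded_set G ->
    exists2 t0, time_set R tau t0 &
      forall t, time_set R tau t -> t0 <= t -> S t @` G `<=` D.
  move=> GV Gb; have [tG TtG SG] := Babs _ GV Gb.
  (* From time [tG] on the orbit is in [B]; a further delay [tB] brings it into [D]. *)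
  exists (tB + tG) => [|t Tt tBGt _ [x Gx <-]]; first exact: time_setD.
  have Tt' : time_set R tau (t - tB).
    apply: time_setB => //; apply: le_trans tBGt.
    by rewrite lerDl (time_set_ge0 TtG).
  exists tB, (S (t - tB) x); split => //.
    have tGt : tG <= t - tB by rewrite lerBrDl.
    by apply: (SG _ Tt' tGt); exists x.
  by rewrite SD ?subrKC//; apply: GV.
exists D; split => //.
- by move=> _ [t [b [Tt tBt Bb' ->]]]; apply: (SB t) => //; exists b.
- have [||t0 Tt0 /(_ t0 Tt0 (lexx _)) SvD] := Dabs [set v].
  + by move=> _ ->.
  + exists `|v|; split; first exact: normr_real.
    by move=> M vM _ ->; apply: ltW.
  + by exists (S t0 v); apply: SvD; exists v.
- move=> t Tt _ [_ [s [b [Ts tBs Bb' ->]] <-]].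
  exists (t + s), b; split => //; first exact: time_setD.
    by apply: le_trans tBs _; rewrite lerDr (time_set_ge0 Tt).
  by rewrite SD//; apply: BV.
Qed.

Lemma bounded_set_diam (R : realType) (X : normedModType R) (B : set X) :
  bounded_set B -> exists2 r : R, 0 < r &
    forall x y, B x -> B y -> `|x - y| <= r.
Proof.
move=> [K [_ BK]]; pose r := `|K| + 1.
have r0 : 0 < r by rewrite ltr_wpDl.
have Br x : B x -> `|x| <= r.
  by apply: BK; rewrite /r; apply: le_lt_trans (ler_norm K) _; rewrite ltrDl.
exists (r + r) => [|x y Bx By]; first by rewrite addr_gt0.
by apply: le_trans (ler_normB _ _) _; rewrite lerD// Br.
Qed.

(** * The limit set of the semigroup and the rate of attraction *)

Section semigroup_dynamics.
Context (R : realType) (X : completeNormedModType R) (tau : time_axis)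
  (V : set X) (S : R -> X -> X) (T : R) (B D : set X) (q r0 : R) (m : nat).
Local Notation TT := (time_set R tau).
Context (V_closed : closed V) (S_semigroup : semigroup tau V S)
  (T_time : TT T) (T_gt0 : 0 < T) (B_absorbing : absorbing tau V S B)
  (DB : D `<=` B) (D0 : D !=set0)
  (SD : forall t, TT t -> S t @` D `<=` D)
  (D_absorbing : forall G, G `<=` V -> bounded_set G ->
    exists2 t0, TT t0 & forall t, TT t -> t0 <= t -> S t @` G `<=` D)
  (m_gt0 : (0 < m)%N) (q01 : 0 < q < 1) (r0_gt0 : 0 < r0)
  (D_diam : forall x y, D x -> D y -> `|x - y| <= r0)
  (S_coloring : forall (F : set X) (r : R), 0 < r -> F `<=` D ->
    (forall x y, F x -> F y -> `|x - y| <= r) ->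
    exists c : X -> nat, (forall x, F x -> (c x < m)%N) /\
      (forall x y, F x -> F y -> c x = c y -> `|S T x - S T y| <= q * r)).
Local Notation W := (iter_image (S T) D).
Local Notation Omega := (omega_limit (S T) D).

Let BV : B `<=` V. Proof. by case: B_absorbing. Qed.
Let DV : D `<=` V. Proof. exact: subset_trans BV. Qed.

Let S_comp t s x : TT t -> TT s -> V x -> S t (S s x) = S (t + s) x.
Proof. by case: S_semigroup => _ _; apply. Qed.

Let subsequence := @omega_limit_subsequence R X (S T) D q r0 m
  m_gt0 q01 r0_gt0 D0 (SD T_time) D_diam S_coloring.

Lemma semigroup_iter n x : V x -> iter n (S T) x = S (n%:R * T) x.
Proof.
move=> Vx; elim: n => [|n IHn].
  by case: S_semigroup => _ S0 _; rewrite mul0r S0.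
rewrite iterS IHn S_comp//; last exact: time_setMn.
by rewrite -[in RHS]natr1 mulrDl mul1r addrC.
Qed.

Lemma multiple_ge t : exists n : nat, t <= n%:R * T.
Proof.
exists (Num.truncn (t / T)).+1.
by rewrite -ler_pdivrMr// ltW// truncnS_gt.
Qed.

(** Splitting [t] into [n * T] and a remainder beyond the absorbing time carries estimates on
    iterates over to all times. *)
Lemma absorbed_iter_image G : G `<=` V -> bounded_set G ->
  exists2 t0, 0 <= t0 & forall n t, TT t -> t0 + n%:R * T <= t ->
    S t @` G `<=` W n.
Proof.
move=> GV Gb; have [t0 Tt0 SG] := D_absorbing GV Gb.
exists t0 => [|n t Tt t0nt _ [x Gx <-]]; first exact: time_set_ge0 Tt0.
have TnT := time_setMn n T_time.
have Tt' : TT (t - n%:R * T).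
  apply: time_setB => //; apply: le_trans t0nt.
  by rewrite lerDr (time_set_ge0 Tt0).
have Dx : D (S (t - n%:R * T) x).
  by apply: (SG _ Tt'); [rewrite lerBrDr|exists x].
exists (S (t - n%:R * T) x) => //.
by rewrite semigroup_iter ?S_comp ?subrKC//; [apply: GV|apply: DV].
Qed.

Lemma omega_limit_sub_closure : Omega `<=` closure D.
Proof.
move=> p /(_ 0%N Logic.I); apply: closureS => _ [x Dx <-]; exact: Dx.
Qed.

Lemma omega_limit_sub : Omega `<=` V.
Proof.
apply: subset_trans omega_limit_sub_closure _.
by apply: subset_trans V_closed; apply: closureS.
Qed.

Lemma cvg_infty_ge (phi : nat -> nat) :
  (forall j, (j <= phi j)%N) -> phi j @[j --> \oo] --> \oo.
Proof.
move=> phiP; apply/cvgnyPge => N; exists N => // j Nj.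
exact: leq_trans Nj (phiP j).
Qed.

Lemma cvg_multiples (phi : nat -> nat) : (forall j, (j <= phi j)%N) ->
  (phi j)%:R * T @[j --> \oo] --> +oo.
Proof.
move=> phiP; apply/cvgryPge => A; have [n An] := multiple_ge A.
exists n => // j nj; apply: le_trans An _.
by rewrite ler_pM2r// ler_nat; apply: leq_trans nj (phiP j).
Qed.

Section asymptotically_closed_semigroup.
Context (S_closed : asymptotically_closed tau V S)
  (B_bounded : bounded_set B).

Lemma bounded_range_D (x : nat -> X) : (forall k, D (x k)) ->
  bounded_set (range x).
Proof.
move=> Dx; have [K [Kr BK]] := B_bounded.
by exists K; split => // M /BK BM _ [k _ <-]; apply/BM/DB.
Qed.

(** Let [p] be the limit of [S (k * T) d_k]. A subsequence of [S (t + k * T) d_k] converges in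
    [Omega]; asymptotic closedness, in place of continuity, identifies its limit with [S t p]. *)
Lemma omega_limit_stable t p : TT t -> Omega p -> Omega (S t p).
Proof.
move=> Tt Op; have [d Dd dp] := omega_limit_seq Op.
have Sd k : D (S t (d k)) by apply: (SD Tt); exists (d k).
have [k|y Oy [phi phiP xy]] :=
    subsequence (x := fun k => iter k (S T) (S t (d k))).
  by exists (S t (d k)).
suff -> : S t p = y by [].
have SE k e : D e -> S (k%:R * T) e = iter k (S T) e.
  by move=> De; rewrite semigroup_iter//; apply: DV.
apply: (S_closed (tk := fun j => (phi j)%:R * T) (xk := d \o phi)) => //.
- by move=> j; apply: time_setMn.
- exact: cvg_multiples.
- by move=> j; apply/DV/Dd.
- by apply: bounded_range_D => j; apply: Dd.
- exact: omega_limit_sub.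
- exact: omega_limit_sub.
- have -> : (fun j => S ((phi j)%:R * T) ((d \o phi) j)) =
      (fun k => iter k (S T) (d k)) \o phi.
    by apply/funext => j /=; rewrite SE.
  by apply: cvg_comp dp; apply: cvg_infty_ge.
- apply: cvg_trans xy; apply: near_eq_cvg; apply: nearW => j /=.
  rewrite -SE// S_comp//; last exact/DV/Dd; last exact: time_setMn.
  by rewrite addrC.
Qed.

(** Stopping [n] steps early, at [S (k * T) d_(k + n)], gives a limit [z] along a subsequence; by
    asymptotic closedness [S (n * T)] maps it to the limit [p] of the full iterates. *)
Lemma omega_limit_preimage n p : Omega p ->
  exists2 z, Omega z & S (n%:R * T) z = p.
Proof.
move=> Op; have [d Dd dp] := omega_limit_seq Op.
have [k|z Oz [phi phiP xz]] :=
    subsequence (x := fun k => iter k (S T) (d (k + n)%N)).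
  by exists (d (k + n)%N).
exists z => //.
apply: (S_closed (tk := fun j => (phi j)%:R * T)
  (xk := fun j => d (phi j + n)%N)) => //.
- exact: time_setMn.
- by move=> j; apply: time_setMn.
- exact: cvg_multiples.
- by move=> j; apply/DV/Dd.
- by apply: bounded_range_D => j; apply: Dd.
- exact: omega_limit_sub.
- exact: omega_limit_sub.
- apply: cvg_trans xz; apply: near_eq_cvg; apply: nearW => j /=.
  by rewrite semigroup_iter//; apply/DV/Dd.
- have -> : (fun j => S (n%:R * T + (phi j)%:R * T) (d (phi j + n)%N)) =
      (fun k => iter k (S T) (d k)) \o (fun j => phi j + n)%N.
    apply/funext => j /=; rewrite semigroup_iter; last exact/DV/Dd.
    by rewrite -mulrDl natrD addrC.
  apply: cvg_comp dp; apply: cvg_infty_ge => j.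
  exact: leq_trans (phiP j) (leq_addr _ _).
Qed.

Lemma omega_limit_invariant t : TT t -> S t @` Omega = Omega.
Proof.
move=> Tt; apply/seteqP; split=> [_ [p Op <-]|p Op].
  exact: omega_limit_stable.
(* A preimage under a larger multiple of [T], moved forward by the difference, is a preimage under
   [S t]. *)
have [n tn] := multiple_ge t; have [z Oz <-] := omega_limit_preimage n Op.
have Tnt : TT (n%:R * T - t) by apply: time_setB => //; apply: time_setMn.
exists (S (n%:R * T - t) z); first exact: omega_limit_stable.
by rewrite S_comp ?subrKC//; apply: omega_limit_sub.
Qed.

(** A priori [Omega] lies only in the closure of [B]. Being bounded, it is sent into [B] by some
    [S (n * T)], and every point of [Omega] is such an image. *)
Lemma omega_limit_absorbed : Omega `<=` B.
Proof.
have Ob : bounded_set Omega.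
  apply: compact_bounded.
  exact: (omega_limit_compact m_gt0 q01 r0_gt0 D0 (SD T_time)).
have [_ Babs] := B_absorbing; have [t0 Tt0 SO] := Babs _ omega_limit_sub Ob.
have [n tn] := multiple_ge t0 => p Op.
have [z Oz <-] := omega_limit_preimage n Op.
by apply: (SO _ (time_setMn n T_time) tn); exists z.
Qed.

Lemma omega_limit_global_attractor : global_attractor tau V S Omega.
Proof.
split.
- exact: (omega_limit_neq0 m_gt0 q01 r0_gt0 D0 (SD T_time)).
- exact: (omega_limit_compact m_gt0 q01 r0_gt0 D0 (SD T_time)).
- exact: omega_limit_sub.
- exact: omega_limit_invariant.
move=> G GV Gb; apply: ge0_cvge0 => [t|e e0]; first exact: semidist_ge0.
have [t0 t00 SG] := absorbed_iter_image GV Gb.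
have [N NP] := omega_limit_attracts m_gt0 q01 r0_gt0 D0 (SD T_time)
  D_diam S_coloring e0.
rewrite near_withinE; near=> t => Tt.
have tN : t0 + N%:R * T <= t by near: t; exact: nbhs_pinfty_ge (num_real _).
apply: semidist_le => [|x /(SG N t Tt tN)/NP[p Op xp]]; first exact: ltW.
by exists p => //; apply: ltW.
Unshelve. all: by end_near. Qed.

End asymptotically_closed_semigroup.

Lemma omega_limit_sub_closed : closed B -> Omega `<=` B.
Proof.
move=> Bcl; apply: subset_trans omega_limit_sub_closure _.
by apply: subset_trans Bcl; apply: closureS.
Qed.

(** Both the approximating iterates and their limit lie in [B], so the Lipschitz bound passes to the
    limit; the images of the [k]-th iterates lie in [W k.+1]. *)
Lemma omega_limit_lipschitz_stable (C : R) : Omega `<=` B ->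
  (forall x y, B x -> B y -> `|S T x - S T y| <= C * `|x - y|) ->
  S T @` Omega `<=` Omega.
Proof.
move=> OB SC _ [p Op <-] n _; have [d Dd dp] := omega_limit_seq Op.
have DW k : D (iter k (S T) (d k)) by apply: (iter_stable (SD T_time)).
have Sdp : S T (iter k (S T) (d k)) @[k --> \oo] --> S T p.
  apply/cvgrPdist_le => e e0; pose K := `|C| + 1.
  have K0 : 0 < K by rewrite ltr_wpDl.
  have /cvgrPdist_le/(_ (e / K)) := dp; rewrite divr_gt0// => /(_ isT).
  apply: filterS => k pd; apply: le_trans (SC _ _ (OB _ Op) (DB (DW k))) _.
  apply: (@le_trans _ _ (K * `|p - iter k (S T) (d k)|)).
    apply: ler_wpM2r => //; apply: le_trans (ler_norm C) _.
    by rewrite /K lerDl.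
  by rewrite mulrC -ler_pdivlMr.
apply: (closed_cvg _ _ _ _ Sdp); first exact: closed_closure.
exists n => // k /= nk; apply: subset_closure.
apply: (iter_image_decr (SD T_time) (n := n) (k := k.+1)); first exact: leqW.
by exists (d k).
Qed.

Lemma exponential_attraction (M0 : set X) :
  (forall n x, W n x -> exists2 y, M0 y & `|x - y| <= q ^+ n * r0) ->
  exists2 xi : R, 0 < xi & forall G, G `<=` V -> bounded_set G ->
    ((expR (xi * t))%:E * semidist (S t @` G) M0)%E
      @[t --> within TT +oo] --> 0%E.
Proof.
move=> WM; have [q0 q1] := andP q01.
pose a := ln q^-1; have a0 : 0 < a by rewrite ln_gt0// invf_gt1.
have qE n : q ^+ n = expR (- (n%:R * a)).
  rewrite /a lnV ?posrE// mulrN opprK mulr_natl -lnXn// lnK//.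
  by rewrite posrE exprn_gt0.
(* This is half of the available rate [a / T]; the other half absorbs the constants due to [t0],
   rounding, [r0] and [e]. *)
pose xi := a / (2 * T); have xi0 : 0 < xi by rewrite divr_gt0// mulr_gt0.
exists xi => // G GV Gb; apply: ge0_cvge0 => [t|e e0].
  by rewrite mule_ge0 ?semidist_ge0// lee_fin expR_ge0.
have [t0 t00 SG] := absorbed_iter_image GV Gb.
rewrite near_withinE; near=> t => Tt.
have tt0 : 0 <= (t - t0) / T.
  rewrite divr_ge0 ?(ltW T_gt0)// subr_ge0; near: t.
  exact: nbhs_pinfty_ge (num_real _).
set n := Num.truncn ((t - t0) / T).
have nt : t0 + n%:R * T <= t.
  by rewrite -lerBrDl -ler_pdivlMr// truncn_le.
have tn : (t - t0) / T < n%:R + 1 by rewrite natr1 truncnS_gt.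
apply: (@le_trans _ _ ((expR (xi * t))%:E * (q ^+ n * r0)%:E)%E).
  apply: lee_wpmul2l; first by rewrite lee_fin expR_ge0.
  apply: semidist_le; first by rewrite mulr_ge0 ?exprn_ge0 ?ltW.
  by move=> x SGx; apply/WM/(SG n t Tt nt).
rewrite -EFinM lee_fin qE mulrA -expRD -ler_pdivlMr//.
rewrite -[X in _ <= X]lnK ?posrE ?divr_gt0// ler_expR.
have h : a * ((t - t0) / T) <= a * (n%:R + 1) by rewrite ler_pM2l// ltW.
have {}h : 2 * xi * t - a * t0 / T <= n%:R * a + a.
  apply: le_trans (_ : _ <= a * ((t - t0) / T)) _; last by move: h; lra.
  by rewrite /xi le_eqVlt; apply/orP; left; apply/eqP; field; rewrite gt_eqF.
(* From this time on, [xi * t] dominates those constants. *)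
have : (a + a * t0 / T - ln (e / r0)) / xi <= t.
  near: t; exact: nbhs_pinfty_ge (num_real _).
by rewrite ler_pdivrMr//; move: h; lra.
Unshelve. all: by end_near. Qed.

End semigroup_dynamics.

(** * Construction of the exponential attractor *)

Lemma exponential_attractor_of_coloring (R : realType)
    (X : completeNormedModType R) (tau : time_axis) (V : set X)
    (S : R -> X -> X) (T : R) (B : set X) (q C : R) (m : nat) :
  V !=set0 -> closed V -> semigroup tau V S ->
  time_set R tau T -> 0 < T ->
  bounded_set B -> absorbing tau V S B ->
  asymptotically_closed tau V S \/ closed B ->
  (0 < m)%N -> 0 < q < 1 ->
  (forall x y, B x -> B y -> `|S T x - S T y| <= C * `|x - y|) ->
  (forall (F : set X) (r : R), 0 < r -> F `<=` B ->
    (forall x y, F x -> F y -> `|x - y| <= r) ->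
    exists c : X -> nat, (forall x, F x -> (c x < m)%N) /\
      (forall x y, F x -> F y -> c x = c y -> `|S T x - S T y| <= q * r)) ->
  exists M0 : set X,
    [/\ discrete_exponential_attractor tau V T S M0,
        M0 `<=` B,
        (fractal_dim V M0 <= elog q^-1 m%:R%:E)%E &
        asymptotically_closed tau V S ->
          exists2 A, global_attractor tau V S A & A `<=` M0].
Proof.
move=> V0 Vcl Ssg Tt T0 Bb Babs Sasym m0 q01 SC coloring.
have [q0 q1] := andP q01; have [BV _] := Babs.
have [D [DB D0 SD Dabs]] := invariant_absorbing_subset V0 Ssg Bb Babs.
have [r r0 Br] := bounded_set_diam Bb.
have Dr x y : D x -> D y -> `|x - y| <= r by move=> /DB Bx /DB; apply: Br.
have Dcol (F : set X) (s : R) : 0 < s -> F `<=` D ->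
    (forall x y, F x -> F y -> `|x - y| <= s) ->
    exists c : X -> nat, (forall x, F x -> (c x < m)%N) /\
      (forall x y, F x -> F y -> c x = c y -> `|S T x - S T y| <= q * s).
  by move=> s0 FD; apply: coloring => // x /FD/DB.
have [E [ED SE EOcpt Eatt Enet]] :=
  exponential_core m0 q01 r0 D0 (SD T Tt) Dr Dcol.
set Omega := omega_limit (S T) D in EOcpt Enet.
(* Either alternative places the limit set inside [B], where the Lipschitz bound on [S T] is
   available. *)
have OB : Omega `<=` B.
  case: Sasym => [Sasym|Bcl]; last exact: omega_limit_sub_closed.
  exact: (omega_limit_absorbed Vcl Ssg Tt T0 Babs DB D0 SD m0 q01 r0 Dr Dcol).
have MB : E `|` Omega `<=` B by move=> x [/ED/DB|/OB].
have dimM : (fractal_dim V (E `|` Omega) <= elog q^-1 m%:R%:E)%E.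
  apply: (fractal_dim_le m0 q01 r0 (subset_trans MB BV)) => n.
  by have [s [ss sE sP]] := Enet n; exists s; split => // u /sE; left.
exists (E `|` Omega); split => //; last first.
  move=> Sas; exists Omega; last by right.
  exact: (omega_limit_global_attractor Vcl Ssg Tt T0 Babs DB D0 SD Dabs
    m0 q01 r0 Dr Dcol Sas Bb).
split.
- split => //; last exact: subset_trans MB BV.
  by have [x Dx] := D0; have [|y Ey _] := Eatt 0%N x; [exists x|exists y; left].
- move=> _ [x [Ex|Ox] <-]; first by left; apply: SE; exists x.
  by right; apply: (omega_limit_lipschitz_stable Tt DB SD OB SC); exists x.
- by apply: le_lt_trans dimM _; rewrite /elog lne_EFin ?ltr0n// -EFinM ltry.
- apply: (exponential_attraction Ssg Tt T0 Babs DB Dabs q01 r0) => n x.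
  by move=> /Eatt[y Ey xy]; exists y => //; left.
Qed.

Lemma exponential_attractor_of_quasi_stability (R : realType)
    (X : completeNormedModType R) (tau : time_axis) (V : set X)
    (S : R -> X -> X) (T : R) (B : set X) (eta : R)
    (Y Z : normedModType R) (iota : {linear Z -> Y}) (M : X -> Z)
    (mu kappa sigma : R) :
  V !=set0 -> closed V -> semigroup tau V S ->
  time_set R tau T -> 0 < T ->
  bounded_set B -> absorbing tau V S B ->
  asymptotically_closed tau V S \/ closed B ->
  0 <= eta < 1 ->
  compact_embedding iota -> 0 < mu -> 0 < kappa ->
  (forall x y, B x -> B y ->
    `|M x - M y| <= kappa * `|x - y| /\
    `|S T x - S T y| <= eta * `|x - y| + mu * `|iota (M x - M y)|) ->
  0 < sigma < 1 - eta ->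
  exists M0 : set X,
    [/\ discrete_exponential_attractor tau V T S M0,
        M0 `<=` B,
        (fractal_dim V M0 <=
          (elog (eta + sigma)^-1
            (separation_number (fun z => `|iota z|)
              (closed_ball (0 : Z) 1) (sigma / (2 * mu * kappa))))%R)%E &
        asymptotically_closed tau V S ->
          exists2 A, global_attractor tau V S A & A `<=` M0].
Proof.
move=> V0 Vcl Ssg Tt T0 Bb Babs Sasym /andP[eta0 eta1] iota_cpt mu0 kappa0 qs.
move=> /andP[sigma0 sigma1].
have e0 : 0 < sigma / (2 * mu * kappa) by rewrite divr_gt0// !mulr_gt0.
have [m [m0 -> mP]] := separation_number_fin iota_cpt e0.
have [_ /linear_bounded_continuous/linear_boundedP iota_bd _] := iota_cpt.
(* A bound on [iota] makes [S T] Lipschitz on [B] with constant [eta + mu * (L * kappa)]. *)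
have [L [L0 iotaL]] : exists L, 0 <= L /\ forall z, `|iota z| <= L * `|z|.
  near (pinfty_nbhs R) => L; exists L; split; near: L => //.
  exact: nbhs_pinfty_ge (num_real _).
apply: (exponential_attractor_of_coloring (C := eta + mu * (L * kappa))) => //.
- by apply/andP; split; lra.
- move=> x y Bx By; have [Mxy /le_trans ->//] := qs x y Bx By.
  rewrite mulrDl lerD2l -mulrA ler_pM2l//; apply: le_trans (iotaL _) _.
  by rewrite -mulrA ler_wpM2l.
- exact: quasi_stable_coloring mu0 kappa0 eta0 sigma0 qs mP.
Unshelve. all: by end_near. Qed.

Theorem theorem4p3 (R : realType) (X : completeNormedModType R)
    (tau : time_axis) (V : set X) (S : R -> X -> X) (T : R) (B : set X)
    (eta : R) :
  V !=set0 -> closed V -> semigroup tau V S ->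
  time_set R tau T -> 0 < T ->
  bounded_set B -> absorbing tau V S B ->
  asymptotically_closed tau V S \/ closed B ->
  0 <= eta < 1 ->
  (* (H1) *)
  (forall (Y Z : normedModType R) (iota : {linear Z -> Y}) (M : X -> Z)
      (mu kappa : R),
    compact_embedding iota -> 0 < mu -> 0 < kappa ->
    (forall x y, B x -> B y ->
      `|M x - M y| <= kappa * `|x - y| /\
      `|S T x - S T y| <= eta * `|x - y| + mu * `|iota (M x - M y)|) ->
    forall sigma : R, 0 < sigma < 1 - eta ->
    exists M0 : set X,
      [/\ discrete_exponential_attractor tau V T S M0,
          M0 `<=` B,
          (fractal_dim V M0 <=
            (elog (eta + sigma)^-1
              (separation_number (fun z => `|iota z|)
                (closed_ball (0 : Z) 1) (sigma / (2 * mu * kappa))))%R)%E &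
          asymptotically_closed tau V S ->
            exists2 A, global_attractor tau V S A & A `<=` M0])
  /\
  (* (H2) *)
  (forall (Y : normedModType R) (iota : {linear X -> Y}) (kappa : R),
    compact_embedding iota -> 0 < kappa ->
    (forall x y, B x -> B y ->
      `|S T x - S T y| <= eta * `|x - y| + kappa * `|iota (x - y)|) ->
    forall sigma : R, 0 < sigma < 1 - eta ->
    exists M0 : set X,
      [/\ discrete_exponential_attractor tau V T S M0,
          M0 `<=` B,
          (fractal_dim V M0 <=
            (elog (eta + sigma)^-1
              (separation_number (fun x => `|iota x|)
                (closed_ball (0 : X) 1) (sigma / (2 * kappa))))%R)%E &
          asymptotically_closed tau V S ->
            exists2 A, global_attractor tau V S A & A `<=` M0]).
Proof.
move=> V0 Vcl Ssg Tt T0 Bb Babs Sasym eta01; split.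
  move=> Y Z iota M mu kappa iota_cpt mu0 kappa0 qs sigma sigma01.
  exact: (exponential_attractor_of_quasi_stability V0 Vcl Ssg Tt T0 Bb Babs
    Sasym eta01 iota_cpt mu0 kappa0 qs sigma01).
move=> Y iota kappa iota_cpt kappa0 qs sigma sigma01.
(* Here [kappa] plays the part of [mu] and the identity has Lipschitz constant 1; that factor 1 is
   made visible in the separation scale. *)
rewrite -[2 * kappa]mulr1.
apply: (exponential_attractor_of_quasi_stability (M := id) V0 Vcl Ssg Tt T0
  Bb Babs Sasym eta01 iota_cpt kappa0 ltr01 _ sigma01) => x y Bx By.
by split; [rewrite mul1r|exact: qs].
Qed.
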